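(* Let $(X,d,\mu)$ be a space of homogeneous type and let $U_n:L^1(X)\to M(X)$, $n=1,2,\ldots$, be linear operators such that (i) $\|U_n\|_{L^1\to M}<\infty$ for every $n$; (ii) if $f\in L^1(X)$ is constant on an open set $G\subset X$, then $U_n(x,f)\to f(x)$ uniformly on every set $E\Subset G$. Then for every null-set $E\subset X$ (that is, $\mu(E)=0$) there exists a set $G\subset X$ (with $\mathbf 1_G\in L^1(X)$) such that for the indicator function $f=\mathbf 1_G$ the sequence $U_n(x,f)$ diverges at every point $x\in E$. Moreover, $$\limsup_{n\to\infty}U_n(x,f)\ge1,\qquad \liminf_{n\to\infty}U_n(x,f)\le0\qquad\text{for all }x\in E.$$
   Context: A quasi-distance on $X$ is a function $d:X\times X\to[0,\infty)$ with $d(x,y)=0$ iff $x=y$, $d(x,y)=d(y,x)$, and $d(x,y)\le K(d(x,z)+d(z,y))$ for a constant $K>0$. Balls are $B(x,r)=\{y\in X: d(y,x)<r\}$. A set $G\subset X$ is open iff for each $x\in G$ there is a ball $B(x,r)\subset G$ (balls themselves need not be open). A space of homogeneous type $(X,d,\mu)$ is a set $X$ with a quasi-distance $d$ and a measure $\mu$ on a $\sigma$-algebra containing all Borel sets and all balls, such that $\mu(B(x,2r))\le C\mu(B(x,r))<\infty$ for all $x,r$, with a constant $C$. $M(X)$ is the space of bounded measurable functions on $X$ with norm $\|f\|_M=\sup_{x\in X}|f(x)|$; $L^1(X)$ is the space of $\mu$-integrable functions. $U_n(x,f)$ denotes the value of $U_n(f)$ at $x$. $\|U_n\|_{L^1\to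 M}$ is the operator norm. $\operatorname{dist}(A,B)=\inf_{x\in A,y\in B}d(x,y)$, and $A\Subset B$ means $\operatorname{dist}(A,B^c)>0$, with $B^c=X\setminus B$ (the infimum over an empty set is $+\infty$).
   Formalization: The formal theorem additionally assumes that every null-set is contained in a Borel null-set (part of Borel regularity of μ); without this the statement fails for some measures on σ-algebras larger than the completed Borel one. *)

(* Defs.v *)
From HB Require Import structures.
From mathcomp Require Export all_boot all_order all_algebra.
From mathcomp Require Export all_classical all_reals all_analysis.
Export Order.TTheory GRing.Theory Num.Theory.
Export numFieldNormedType.Exports.

Set Implicit Arguments.
Unset Strict Implicit.
Unset Printing Implicit Defensive.

Local Open Scope classical_set_scope.
Local Open Scope ring_scope.

Definition quasi_distance (R : realType) (X : Type) (rho : X -> X -> R) : Prop :=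
  [/\ forall x y, 0 <= rho x y,
      forall x y, rho x y = 0 <-> x = y,
      forall x y, rho x y = rho y x &
      exists2 K : R, 0 < K &
        forall x y z, rho x y <= K * (rho x z + rho z y)].

Definition qball (R : realType) (X : Type) (rho : X -> X -> R) (x : X) (r : R) :
  set X := [set y | rho y x < r].

Definition qopen (R : realType) (X : Type) (rho : X -> X -> R) : set (set X) :=
  [set G | forall x, G x -> exists2 r : R, 0 < r & qball rho x r `<=` G].

Definition qborel (R : realType) (X : Type) (rho : X -> X -> R) : set (set X) :=
  <<s qopen rho >>.

Definition homogeneous_type (R : realType) (d : measure_display)
    (X : measurableType d) (rho : X -> X -> R) (mu : {measure set X -> \bar R}) :
    Prop :=
  [/\ quasi_distance rho,
      qborel rho `<=` measurable,
      forall x r, measurable (qball rho x r) &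
      exists C : R, forall x r, 0 < r ->
        (mu (qball rho x (2 * r)) <= C%:E * mu (qball rho x r))%E /\
        (mu (qball rho x r) < +oo)%E].

(* Part of the usual requirement that [mu] be Borel regular, restricted to null
   sets.  It holds for free if every measurable set is Borel, or lies in the
   completion of the Borel sets. *)
Definition borel_null_sets (R : realType) (d : measure_display)
    (X : measurableType d) (rho : X -> X -> R) (mu : {measure set X -> \bar R}) :
    Prop :=
  forall E, measurable E -> mu E = 0%E ->
    exists B, [/\ qborel rho B, E `<=` B & mu B = 0%E].

(* [ereal_inf set0 = +oo] *)
Definition qdist (R : realType) (X : Type) (rho : X -> X -> R) (A B : set X) :
  \bar R := ereal_inf [set (rho p.1 p.2)%:E | p in A `*` B].

Definition well_inside (R : realType) (X : Type) (rho : X -> X -> R)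
  (A B : set X) : Prop := (0 < qdist rho A (~` B))%E.

(* Integrable functions, not classes: an operator of finite norm (below) on this
   space takes the same value on functions that are equal almost everywhere, so
   it is the same thing as an operator of finite norm on classes. *)
Notation L1 mu := (LfunType mu (@lexx _ _ 1%E)).

Definition bounded_measurable (R : realType) (d : measure_display)
    (X : measurableType d) : set (X -> R) :=
  [set g : X -> R | measurable_fun setT g /\ [bounded g x | x in [set: X]]].

Definition sup_norm (R : realType) (X : Type) (g : X -> R) : \bar R :=
  ereal_sup [set `|g x|%:E | x in [set: X]].

Definition op_norm (R : realType) (d : measure_display) (X : measurableType d)
    (mu : {measure set X -> \bar R}) (T : L1 mu -> X -> R) : \bar R :=
  ereal_sup [set sup_norm (T f) | f in
    [set f : L1 mu | ('N[mu]_1%E[EFin \o f] <= 1)%E]].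

(* Main.v *)
Require Import Defs.
From mathcomp Require Import measurable_realfun.

(** By localization, [U n f] is close to [c] at [x] for large [n] as soon as [f]
    is constantly [c] on a ball around [x], uniformly in [x] for balls of one
    radius.  So build sets [H 0], [H 1], ... converging to some [Hoo], together
    with times [n_0], [n_1], ... such that [U (n_s) (\1_(H s))] has settled,
    up to [a s], at all points [x] whose ball of radius [a s = 1 / (s + 1)] lies
    in [H s] or misses it.  If the later changes have a total measure that is
    tiny compared with the inverse of the norm of [U (n_s)], then
    [U (n_s) (\1_Hoo)] has settled at the same points too.  It remains to make
    every point of the null set [E] see such a ball inside [H s] for infinitely
    many [s], and such a ball outside [H s] for infinitely many [s], while step
    [s] is only allowed to modify [H s] on a set whose measure is bounded by a
    number that depends on the past ([exists_oscillating_sets]).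

    A neighbourhood of [E] that is open and of small measure exists at every
    step ([borel_null_cover]), but flipping [H s] on all of it would spoil the
    balls around points close to its boundary.  The sets are therefore read off
    a tower of open sets [G s 0 = X], [G s 1], [G s 2], ..., decreasing in the
    level and increasing with the step: [H s] consists of the points whose
    highest level is odd.  Say that [x] has depth [r] in a set if the set
    contains the ball of center [x] and radius [r].  At each step, level [k + 1] grows by a part of a
    small neighbourhood of [E], but only within the points that lie at depth
    [2 K a_s] in level [k] ([tower_step]).  Two things follow:
    - every point of [E] reaches every level, since the required depth tends
      to zero ([tower_reach]);
    - at the first step [t] at which a point has depth [a t] in level [k], level
      [k + 1] is still away from the ball of radius [a t]: its points were added
      at earlier steps [j] and had depth [2 K a_j] in level [k]; by the
      quasi-triangle inequality, a point of depth less than [a j] in level [k]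
      at step [j] is not within [a j] of them ([tower_layer]).
    Hence every point of [E] sees, for every [k], a ball on which the highest
    level is exactly [k], and the parity of [k] is at our disposal.  The step at
    which this happens is at least [k], because only levels up to [s] are
    nonempty at step [s]. *)

Local Open Scope classical_set_scope.
Local Open Scope ring_scope.

(** * Balls and interiors in a quasi-metric space *)

Lemma ex_natSinv_lt {R : realType} {e : R} : 0 < e -> exists n, n.+1%:R^-1 < e.
Proof.
by move=> e0; have [N _ /(_ _ (leqnn N))] := near_infty_natSinv_lt (PosNum e0);
  exists N.
Qed.

Section quasi_metric.
Set Implicit Arguments.
Unset Strict Implicit.
Context (R : realType) (X : Type) (rho : X -> X -> R) (K : R).
Hypothesis rhoxx : forall x, rho x x = 0.
Hypothesis rhoC : forall x y, rho x y = rho y x.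
Hypothesis K0 : 0 < K.
Hypothesis rho_tri : forall x y z, rho x y <= K * (rho x z + rho z y).

(** The quasi-distance need not be continuous and balls need not be open, but
    this interior is open: shrinking radii by the factor [2 K] makes up for the
    quasi-triangle inequality ([open_qint]). *)
Definition qint (A : set X) : set X :=
  [set x | exists2 r : R, 0 < r & qball rho x r `<=` A].

Lemma qball_center x r : 0 < r -> qball rho x r x.
Proof. by rewrite /qball /= rhoxx. Qed.

Lemma qball_sub y r r' : r <= r' -> qball rho y r `<=` qball rho y r'.
Proof. by move=> rr z; rewrite /qball /= => /lt_le_trans; apply. Qed.

Lemma qint_sub A : qint A `<=` A.
Proof. by move=> x [r r0]; apply; exact: qball_center. Qed.

Lemma qball_trans x y r : qball rho x r y ->
  qball rho y r `<=` qball rho x (2 * K * r).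
Proof.
rewrite /qball /= => yx z /= zy; apply: (le_lt_trans (rho_tri _ _ y)).
by rewrite -mulrA mulrCA ltr_pM2l// mulr_natl mulr2n ltrD.
Qed.

Lemma qint_deep A x r : 0 < r -> qball rho x (2 * K * r) `<=` A ->
  qint [set y | qball rho y r `<=` A] x.
Proof. by move=> r0 xA; exists r => // y /qball_trans yx z /yx /xA. Qed.

Lemma open_qint A : qopen rho (qint A).
Proof.
move=> x [r r0 xA]; exists (r / (2 * K)); first by rewrite divr_gt0// mulr_gt0.
move=> y yx; exists (r / (2 * K)); first by rewrite divr_gt0// mulr_gt0.
have := qball_trans yx; rewrite (mulrC (2 * K)) divfK ?gt_eqF ?mulr_gt0// => yx'.
exact: (subset_trans yx').
Qed.

Lemma qopenI A B : qopen rho A -> qopen rho B -> qopen rho (A `&` B).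
Proof.
move=> oA oB x [/oA[r r0 rA] /oB[s s0 sB]]; exists (Num.min r s).
  by rewrite lt_min r0.
by move=> y; rewrite /qball /= lt_min => /andP[? ?]; split; [exact: rA|exact: sB].
Qed.

Lemma qopen_bigcup (I : Type) (D : set I) (F : I -> set X) :
  (forall i, qopen rho (F i)) -> qopen rho (\bigcup_(i in D) F i).
Proof.
move=> oF x [i Di /oF[r r0 rF]]; exists r => // y /rF ?; by exists i.
Qed.

Lemma qopenU A B : qopen rho A -> qopen rho B -> qopen rho (A `|` B).
Proof.
by move=> oA oB x [/oA|/oB] [r r0 rA]; exists r => // y /rA; [left|right].
Qed.

(** Localization speaks of open sets, while [A] is arbitrary.  Points of depth
    [r] in [A] keep the distance [r / (2 K)] from the complement of the interior
    of [A], so the open set can be this interior. *)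
Lemma well_inside_qint (P A : set X) r : 0 < r ->
  (forall x, P x -> qball rho x r `<=` A) -> well_inside rho P (qint A).
Proof.
move=> r0 PA; rewrite /well_inside.
have r2 : 0 < r / (2 * K) by rewrite divr_gt0// mulr_gt0.
apply: (@lt_le_trans _ _ (r / (2 * K))%:E); first by rewrite lte_fin.
apply: le_ereal_inf_tmp => _ [[x y] /= [Px Ay] <-]; rewrite lee_fin leNgt.
apply/negP => xy; apply: Ay; exists (r / (2 * K)) => //.
apply: subset_trans (PA x Px).
have /qball_trans : qball rho x (r / (2 * K)) y by rewrite /qball /= rhoC.
by rewrite (mulrC (2 * K)) divfK ?gt_eqF ?mulr_gt0.
Qed.

End quasi_metric.

(** * Borel null sets have small open neighbourhoods *)

Section borel_regularity.
Set Implicit Arguments.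
Unset Strict Implicit.
Context (R : realType) (d : measure_display) (X : measurableType d)
  (rho : X -> X -> R) (K : R) (mu : {measure set X -> \bar R}).
Hypothesis rhoxx : forall x, rho x x = 0.
Hypothesis rhoC : forall x y, rho x y = rho y x.
Hypothesis K0 : 0 < K.
Hypothesis rho_tri : forall x y z, rho x y <= K * (rho x z + rho z y).
Hypothesis mopen : forall A, qopen rho A -> measurable A.

Lemma measure_nonincreasing_small (F : nat -> set X) (e e' : R) :
  (forall n, measurable (F n)) -> nonincreasing_seq F ->
  (mu (F 0%N) < +oo)%E -> (mu (\bigcap_n F n) <= e%:E)%E -> e < e' ->
  exists n, (mu (F n) <= e'%:E)%E.
Proof.
move=> mF ndF F0 Fe ee'; apply: contrapT => /forallNP nF.
have cF := nonincreasing_cvg_mu F0 mF (bigcapT_measurable mF) ndF.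
have : (e'%:E <= mu (\bigcap_n F n))%E.
  rewrite -(cvg_lim _ cF)//; apply: lime_ge; first by apply/cvg_ex; eexists; exact: cF.
  by apply: nearW => n; rewrite leNgt; apply/negP => /ltW; exact: nF.
by move=> /le_trans/(_ Fe); rewrite lee_fin leNgt ee'.
Qed.

(** [~` Q] is a closed set inside [A], so this is regularity from both sides
    for the finite measure [mu (_ `&` V)]; open neighbourhoods of [A] and [~` A]
    make the condition symmetric under complement. *)
Definition sandwiched (V A : set X) := forall e : R, 0 < e -> exists P Q,
  [/\ qopen rho P /\ qopen rho Q, A `<=` P, ~` A `<=` Q &
      (mu (P `&` Q `&` V) <= e%:E)%E].

Section finite_part.
Variable V : set X.
Hypotheses (mV : measurable V) (finV : (mu V < +oo)%E).

Let mPQV P Q : qopen rho P -> qopen rho Q -> measurable (P `&` Q `&` V).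
Proof. by move=> /mopen mP /mopen mQ; do 2 apply: measurableI => //. Qed.

Let finPQV P Q : qopen rho P -> qopen rho Q -> (mu (P `&` Q `&` V) < +oo)%E.
Proof.
move=> oP oQ; apply: le_lt_trans finV; apply: le_measure; rewrite ?inE//.
exact: mPQV.
Qed.

(** The closures of the sets of points at depth [1 / (n + 1)] in an open set
    exhaust it, and [Q n] is the complement of such a closure. *)
Lemma sandwiched_open A : qopen rho A -> sandwiched V A.
Proof.
move=> oA e e0; pose Q n := qint rho (~` [set x | qball rho x n.+1%:R^-1 `<=` A]).
have oQ n : qopen rho (Q n) by exact: open_qint rho_tri _.
have [n Qn] : exists n, (mu (A `&` Q n `&` V) <= e%:E)%E.
  apply: (measure_nonincreasing_small (F := fun n => A `&` Q n `&` V) _ _ _ _ e0).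
  - by move=> n; exact: mPQV.
  - move=> m n mn; apply/subsetPset; apply: setSI; apply: setIS.
    move=> x [r r0 xr]; exists r => // y /xr /= yA yA'; apply: yA.
    apply: subset_trans yA'; apply: qball_sub.
    by rewrite lef_pV2 ?posrE// ler_nat.
  - exact: finPQV.
  - rewrite (_ : \bigcap_n _ = set0) ?measure0//.
    apply/seteqP; split=> // x xF; have [[Ax _] _] := xF 0%N I.
    have [r r0 xr] := oA _ Ax.
    have [n nr] := ex_natSinv_lt r0.
    have [[_ /(qint_sub rhoxx) nx] _] := xF n I; apply: nx.
    by apply: subset_trans xr; apply: qball_sub; exact: ltW.
exists A, (Q n); split => // x nAx; exists n.+1%:R^-1 => // y yx /= yA.
by apply: nAx; apply: yA; rewrite /qball /= rhoC.
Qed.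

Lemma sandwichedC A : sandwiched V A -> sandwiched V (~` A).
Proof.
move=> sA e /sA[P [Q [[oP oQ] AP AQ PQ]]]; exists Q, P; split => //.
  by rewrite setCK.
by rewrite (setIC Q).
Qed.

Lemma qopen_bigcap_ord (Q : nat -> set X) n :
  (forall i, qopen rho (Q i)) -> qopen rho (\bigcap_(i < n) Q i).
Proof.
move=> oQ; elim: n => [|n IH].
  by move=> x _; exists 1 => // y _ i.
rewrite (_ : \bigcap_(i < n.+1) _ = (\bigcap_(i < n) Q i) `&` Q n).
  exact: qopenI.
by rewrite !bigcap_mkord big_ord_recr.
Qed.

(** The intersection of all the neighbourhoods of the complements [~` A i] need
    not be open, so it is replaced by a finite one, which costs the other half of
    [e]. *)
Lemma sandwiched_bigcup (A : nat -> set X) :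
  (forall i, sandwiched V (A i)) -> sandwiched V (\bigcup_i A i).
Proof.
move=> sA e e0; have e2 : 0 < e / 2 by rewrite divr_gt0.
have ei i : 0 < e / 2 / (2 ^ i.+1)%:R by rewrite divr_gt0// ltr0n expn_gt0.
have /choice[PQ PQP] : forall i, exists PQ : set X * set X,
  [/\ qopen rho PQ.1 /\ qopen rho PQ.2, A i `<=` PQ.1, ~` A i `<=` PQ.2 &
      (mu (PQ.1 `&` PQ.2 `&` V) <= (e / 2 / (2 ^ i.+1)%:R)%:E)%E].
  by move=> i; have [P [Q ?]] := sA i _ (ei i); exists (P, Q).
pose P := \bigcup_i (PQ i).1; pose Q n := \bigcap_(i < n) (PQ i).2.
have oP : qopen rho P by apply: qopen_bigcup => i; case: (PQP i) => -[].
have oQ n : qopen rho (Q n) by apply: qopen_bigcap_ord => i; case: (PQP i) => -[].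
have mi i : measurable ((PQ i).1 `&` (PQ i).2 `&` V).
  by apply: mPQV; case: (PQP i) => -[].
have [n Qn] : exists n, (mu (P `&` Q n `&` V) <= e%:E)%E.
  apply: (measure_nonincreasing_small (F := fun n => P `&` Q n `&` V) (e := e / 2)).
  - by move=> n; exact: mPQV.
  - move=> m n mn; apply/subsetPset; apply: setSI; apply: setIS.
    by move=> x xQ i /= im; apply: xQ => /=; exact: leq_trans mn.
  - exact: finPQV.
  - apply: (@le_trans _ _ (\sum_(i <oo) mu ((PQ i).1 `&` (PQ i).2 `&` V))%E).
      apply: measure_sigma_subadditive => //.
        by apply: bigcapT_measurable => n; exact: mPQV.
      move=> x xF; have [[[i _ Pi] _] Vx] := xF 0%N I; exists i => //.
      by split => //; split => //; have [[_ +] _] := xF i.+1 I; apply => /=.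
    apply: le_trans (epsilon_trick0 xpredT (ltW e2)).
    by apply: lee_nneseries => // i _; case: (PQP i).
  - by rewrite ltr_pdivrMr// ltr_pMr// ltr1n.
exists P, (Q n); split => //.
  by move=> x [i _ Ai]; exists i => //; case: (PQP i) => _ + _ _; exact.
move=> x nA i _; case: (PQP i) => _ _ + _; apply => Ai; apply: nA.
by exists i.
Qed.

Lemma sandwiched_borel : qborel rho `<=` sandwiched V.
Proof.
apply: smallest_sub; last exact: sandwiched_open.
split.
- by apply: sandwiched_open => x.
- by move=> A; rewrite setTD; exact: sandwichedC.
- exact: sandwiched_bigcup.
Qed.

End finite_part.

(** The space is covered by countably many open sets [V n] of finite measure, on
    each of which regularity gives a neighbourhood of [B]; the union of their
    traces is small. *)
Lemma borel_null_cover (B : set X) :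
  (forall x r, measurable (qball rho x r)) ->
  (forall x r, 0 < r -> (mu (qball rho x r) < +oo)%E) ->
  qborel rho B -> mu B = 0%E ->
  forall e : R, 0 < e ->
  exists O, [/\ qopen rho O, B `<=` O & (mu O <= e%:E)%E].
Proof.
move=> mball finball bB B0 e e0.
have mB : measurable B.
  have : sigma_algebra setT (@measurable _ X) by exact: sigma_algebra_measurable.
  by move=> sX; apply: (smallest_sub sX mopen).
have [->|/set0P[x0 _]] := eqVneq B set0.
  by exists set0; split => //; rewrite measure0 lee_fin ltW.
pose V n := qint rho (qball rho x0 n.+1%:R).
have oV n : qopen rho (V n) by exact: open_qint rho_tri _.
have finV n : (mu (V n) < +oo)%E.
  apply: le_lt_trans (finball x0 n.+1%:R (ltr0Sn _ _)).
  by apply: le_measure; rewrite ?inE//; [exact: mopen|exact: qint_sub].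
have ei i : 0 < e / (2 ^ i.+1)%:R by rewrite divr_gt0// ltr0n expn_gt0.
have /choice[P PP] : forall i, exists P : set X,
  [/\ qopen rho P, B `<=` P & (mu (P `&` V i) <= (e / (2 ^ i.+1)%:R)%:E)%E].
  move=> i; have [P [Q [[oP oQ] BP BQ PQ]]] :=
    sandwiched_borel (mopen (oV i)) (finV i) bB (ei i).
  exists P; split => //; apply: le_trans PQ.
  have mPV : measurable (P `&` V i) by apply: measurableI; exact: mopen.
  have mPQV : measurable (P `&` Q `&` V i).
    by apply: measurableI; [apply: measurableI|]; exact: mopen.
  rewrite -[leRHS]add0e -B0.
  apply: (@le_trans _ _ (mu (B `|` (P `&` Q `&` V i)))); last first.
    exact: measureU2.
  apply: le_measure; rewrite ?inE//; first exact: measurableU.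
  move=> x [Px Vx]; have [Bx|/BQ Qx] := pselect (B x); [by left|by right].
exists (\bigcup_i (P i `&` V i)); split.
- by apply: qopen_bigcup => i; apply: qopenI => //; case: (PP i).
- move=> x Bx.
  pose n := Num.truncn (K * (1 + rho x x0)).
  have xn : K * (1 + rho x x0) < n.+1%:R by exact: truncnS_gt.
  exists n => //; split; first by case: (PP n) => _ + _; exact.
  exists 1 => // y yx; rewrite /qball /=.
  apply: le_lt_trans xn; apply: le_trans (rho_tri _ _ x) _.
  by rewrite ler_pM2l// lerD2r ltW.
- apply: le_trans (epsilon_trick0 xpredT (ltW e0)).
  have mPV i : measurable (P i `&` V i).
    by apply: measurableI; apply: mopen => //; case: (PP i).
  apply: (@le_trans _ _ (\sum_(i <oo) mu (P i `&` V i))%E).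
    by apply: measure_sigma_subadditive => //; exact: bigcupT_measurable.
  by apply: lee_nneseries => // i _; case: (PP i).
Qed.

End borel_regularity.

(** * Towers of open sets *)

Section tower.
Set Implicit Arguments.
Unset Strict Implicit.
Context (R : realType) (X : Type) (rho : X -> X -> R) (K : R).
Hypothesis rhoxx : forall x, rho x x = 0.
Hypothesis rhoC : forall x y, rho x y = rho y x.
Hypothesis K0 : 0 < K.
Hypothesis rho_tri : forall x y z, rho x y <= K * (rho x z + rho z y).

(** Towers are decreasing sequences of sets, the levels, that start at the whole
    space. *)
Definition tower0 (k : nat) : set X := if k is 0%N then setT else set0.

(** Level [k + 1] may grow only at points that have depth [r] in level [k].  The
    interior keeps the levels open. *)
Definition tower_step (r : R) (O : set X) (G : nat -> set X) (k : nat) : set X :=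
  if k is k'.+1
  then G k `|` (O `&` qint rho [set y | qball rho y r `<=` G k'])
  else setT.

(** In a tower, these are the points whose highest level is odd. *)
Definition odd_part (G : nat -> set X) : set X :=
  [set x | exists2 k, odd k & (G k `\` G k.+1) x].

Variables (a : nat -> R) (O : nat -> set X) (G : nat -> nat -> set X).
Hypothesis a0 : forall s, 0 < a s.
Hypothesis a_nincr : forall s t, (s <= t)%N -> a t <= a s.
Hypothesis G0 : G 0%N = tower0.
Hypothesis GS : forall s, G s.+1 = tower_step (2 * K * a s) (O s) (G s).

Lemma tower_level0 s x : G s 0 x.
Proof. by case: s => [|s]; rewrite ?G0 ?GS. Qed.

Lemma tower_mono k s t : (s <= t)%N -> G s k `<=` G t k.
Proof.
move=> /subnK <-; elim: (t - s)%N => [|n IH] //= x /IH.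
by rewrite addSn GS; case: k {IH} => [|k] //=; left.
Qed.

(** A point remembers the step at which it was added: it had depth [2 K a_j] in
    the level below, and level [k] has only grown since. *)
Lemma tower_ball t k y : G t k.+1 y ->
  exists2 j, (j < t)%N & qball rho y (2 * K * a j) `<=` G j k.
Proof.
elim: t => [|t IH]; first by rewrite G0.
rewrite GS => -[/IH[j jt yj]|[_ /(qint_sub rhoxx) yt]]; last by exists t.
by exists j => //; rewrite ltnS ltnW.
Qed.

Lemma tower_nestS s k : G s k.+1 `<=` G s k.
Proof.
move=> x /tower_ball[j js]; move/(_ x (qball_center rhoxx x _)).
by rewrite !mulr_gt0// => /(_ isT); apply: tower_mono; exact: ltnW.
Qed.

Lemma tower_nest s k l : (k <= l)%N -> G s l `<=` G s k.
Proof.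
move=> /subnK <-; elim: (l - k)%N => [|n IH] //= x.
by rewrite addSn => /tower_nestS /IH.
Qed.

Lemma tower_height s k x : G s k x -> (k <= s)%N.
Proof.
elim: k s => [//|k IH] s /tower_ball[j js].
move/(_ x (qball_center rhoxx x _)); rewrite !mulr_gt0// => /(_ isT) /IH kj.
exact: leq_ltn_trans js.
Qed.

Lemma odd_part_layer s k x : (G s k `\` G s k.+1) x ->
  odd_part (G s) x <-> odd k.
Proof.
move=> [Gk nGk]; split=> [[l ol [Gl nGl]]|ok]; last by exists k.
suff -> : k = l by [].
apply/eqP; rewrite eqn_leq; apply/andP; split; rewrite leqNgt; apply/negP.
  by move=> lk; apply: nGl; apply: (tower_nest lk).
by move=> kl; apply: nGk; apply: (tower_nest kl).
Qed.

Lemma odd_part_sub s : odd_part (G s) `<=` \bigcup_j O j.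
Proof.
move=> x [k]; case: k => // k _ [Gk _].
have {k Gk} : G s 1%N x by apply: tower_nest Gk.
elim: s => [|s IH]; first by rewrite G0.
by rewrite GS => -[/IH//|[Ox _]]; exists s.
Qed.

Lemma tower_stable s t k x : (s <= t)%N -> ~ (\bigcup_j O (s + j)%N) x ->
  G t k x -> G s k x.
Proof.
move=> /subnKC <- nO; elim: (t - s)%N => [|n IH]; first by rewrite addn0.
rewrite addnS GS; case: k IH => [|k] IH; first by move=> _; exact: tower_level0.
by case=> [/IH//|[Ox _]]; exfalso; apply: nO; exists n.
Qed.

(** All changes after step [s] take place in the sets [O (s + j)]. *)
Lemma odd_part_limit s x : ~ (\bigcup_j O (s + j)%N) x ->
  odd_part (fun k => \bigcup_t G t k) x <-> odd_part (G s) x.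
Proof.
move=> nO; have Gs k : (\bigcup_t G t k) x <-> G s k x.
  split=> [[t _ Gt]|]; last by exists s.
  have [st|/ltnW ts] := leqP s t; first exact: tower_stable Gt.
  exact: tower_mono Gt.
by split=> -[k ok [Gk nGk]]; exists k => //; split;
  [exact/Gs|move/Gs|exact/Gs|move/Gs].
Qed.

Lemma tower_open s k : (forall s, qopen rho (O s)) -> qopen rho (G s k).
Proof.
move=> oO; elim: s k => [|s IH] k.
  rewrite G0; case: k => [|k] //= x _; by exists 1.
rewrite GS; case: k => [|k] /=; first by move=> x _; exists 1.
apply: qopenU => //; apply: qopenI => //; exact: open_qint rho_tri _.
Qed.

Section at_point.
Hypothesis a_cvg : forall e : R, 0 < e -> exists n, a n < e.
Hypothesis oO : forall s, qopen rho (O s).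
Variable x : X.
Hypothesis Ox : forall s, O s x.

Lemma tower_small e : 0 < e -> forall n, exists2 s, (n <= s)%N & a s < e.
Proof.
move=> /a_cvg[m am] n; exists (maxn m n); first exact: leq_maxr.
by apply: le_lt_trans am; apply: a_nincr; exact: leq_maxl.
Qed.

Lemma tower_reach k : exists s, G s k x.
Proof.
elim: k => [|k [s Gs]]; first by exists 0%N; rewrite G0.
have [e e0 xe] := tower_open oO Gs.
have K2 : 0 < 2 * K * (2 * K) by rewrite !mulr_gt0.
have [t st ate] := tower_small (divr_gt0 e0 K2) s.
exists t.+1; rewrite GS; right; split => //.
apply: (qint_deep K0 rho_tri); first by rewrite !mulr_gt0.
move=> y yx; apply: (tower_mono st); apply: xe; apply: (qball_sub _ yx).
by rewrite mulrA mulrC -ler_pdivlMr// ltW.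
Qed.

(** Take the first step [t] at which [x] has depth [a t] in level [k].  A point
    of level [k + 1] within [a t] of [x] was added at some step [j < t], and
    then its depth [2 K a_j] in level [k] would have given [x] depth [a j] at
    step [j]. *)
Lemma tower_layer k : exists2 t, (k <= t)%N &
  qball rho x (a t) `<=` G t k `\` G t k.+1.
Proof.
have ext : exists t, `[< qball rho x (a t) `<=` G t k >].
  have [s Gs] := tower_reach k; have [e e0 xe] := tower_open oO Gs.
  have [t st te] := tower_small e0 s; exists t; apply/asboolP => y yx.
  by apply: (tower_mono st); apply: xe; apply: (qball_sub _ yx); exact: ltW.
case: (ex_minnP ext) => t /asboolP xt tmin; exists t.
  by apply: (@tower_height t k x); apply: xt; exact: qball_center.
move=> y yx; split; first exact: xt.
move=> /tower_ball[j jt yj].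
have : ~ qball rho x (a j) `<=` G j k.
  by move=> /asboolP /tmin; rewrite leqNgt jt.
apply; apply: subset_trans yj; apply: (qball_trans K0 rho_tri).
by rewrite /qball /= rhoC; apply: (qball_sub (a_nincr (ltnW jt)) yx).
Qed.

(** Apply [tower_layer] to a level of the prescribed parity, at least [n]. *)
Lemma tower_oscillate (b : bool) n : exists2 t, (n <= t)%N &
  forall y, rho y x < a t -> odd_part (G t) y <-> b.
Proof.
have [t nt xt] := tower_layer (n.*2 + b)%N; exists t.
  by apply: leq_trans nt; rewrite -addnn -addnA leq_addr.
move=> y /xt /odd_part_layer ->; by rewrite oddD odd_double oddb.
Qed.

End at_point.
End tower.

(** * Oscillation under prescribed error bounds *)

Section oscillating_sets.
Set Implicit Arguments.
Unset Strict Implicit.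
Context (R : realType) (d : measure_display) (X : measurableType d)
  (rho : X -> X -> R) (K : R) (mu : {measure set X -> \bar R}).
Hypothesis rhoxx : forall x, rho x x = 0.
Hypothesis rhoC : forall x y, rho x y = rho y x.
Hypothesis K0 : 0 < K.
Hypothesis rho_tri : forall x y z, rho x y <= K * (rho x z + rho z y).
Hypothesis mopen : forall A, qopen rho A -> measurable A.

Lemma measurable_odd_part (G : nat -> set X) :
  (forall k, measurable (G k)) -> measurable (odd_part G).
Proof.
move=> mG; rewrite (_ : odd_part G = \bigcup_(k in [set k | odd k]) (G k `\` G k.+1)).
  by apply: bigcup_measurable => k _; exact: measurableD.
by apply/seteqP; split=> x [k ok Gx]; exists k.
Qed.

(** The error bound [Phi s] may depend on the set built up to step [s], as it
    will involve the norm of an operator chosen in terms of that set.  So the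
    recursion carries, next to the tower, the minimum [th s] of all bounds met
    so far, and step [s] modifies the tower in a set of measure at most
    [th s / 2 ^ (s + 1)]; the changes from step [s] on then add up to at most
    [th s], as [th] is nonincreasing. *)
Lemma exists_oscillating_sets (E : set X) (a : nat -> R)
    (Phi : nat -> set X -> R) :
  (forall e : R, 0 < e ->
    exists O, [/\ qopen rho O, E `<=` O & (mu O <= e%:E)%E]) ->
  (forall s, 0 < a s) -> (forall s t, (s <= t)%N -> a t <= a s) ->
  (forall e : R, 0 < e -> exists n, a n < e) ->
  (forall s H, 0 < Phi s H) ->
  exists (H : nat -> set X) (Hoo : set X),
    [/\ forall s, measurable (H s) /\ (mu (H s) < +oo)%E,
        measurable Hoo /\ (mu Hoo < +oo)%E,
        forall s, (mu ((H s `\` Hoo) `|` (Hoo `\` H s)) <= (Phi s (H s))%:E)%E &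
        forall x, E x -> forall (b : bool) n, exists2 t, (n <= t)%N &
          forall y, rho y x < a t -> H t y <-> b].
Proof.
move=> Ecover a0 a_nincr a_cvg Phi0.
have /choice[cover_of cover_ofP] : forall e, exists O, 0 < e ->
    [/\ qopen rho O, E `<=` O & (mu O <= e%:E)%E].
  move=> e; have [e0|_] := ltP 0 e; last by exists set0.
  by have [W WP] := Ecover e e0; exists W.
pose size s (th : R) := th / (2 ^ s.+1)%:R.
pose next s (st : (nat -> set X) * R) :=
  let G := tower_step rho (2 * K * a s) (cover_of (size s st.2)) st.1 in
  (G, Num.min st.2 (Phi s.+1 (odd_part G))).
pose st0 : (nat -> set X) * R := (@tower0 X, Phi 0%N (odd_part (@tower0 X))).
pose st := fix st (s : nat) := if s is s'.+1 then next s' (st s') else st0.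
pose G s := (st s).1; pose th s := (st s).2; pose O s := cover_of (size s (th s)).
have GS s : G s.+1 = tower_step rho (2 * K * a s) (O s) (G s) by [].
have th0 s : 0 < th s.
  elim: s => [|s IH]; first exact: Phi0.
  by rewrite /th /= lt_min IH Phi0.
have thle s : th s <= Phi s (odd_part (G s)).
  by case: s => [|s]; [exact: lexx|rewrite /th /= ge_min lexx orbT].
have th_nincr s t : th (s + t)%N <= th s.
  elim: t => [|t IH]; first by rewrite addn0.
  by rewrite addnS; apply: le_trans IH; rewrite /th /= ge_min lexx.
have OP s : [/\ qopen rho (O s), E `<=` O s & (mu (O s) <= (size s (th s))%:E)%E].
  by apply: cover_ofP; rewrite divr_gt0// ltr0n expn_gt0.
have oO s : qopen rho (O s) by case: (OP s).
have mO s : measurable (O s) by exact: mopen.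
have mG s k : measurable (G s k).
  by apply: mopen; exact: (@tower_open _ _ rho K K0 rho_tri a O G).
have tail s : (mu (\bigcup_j O (s + j)%N) <= (th s)%:E)%E.
  apply: (@le_trans _ _ (\sum_(j <oo) mu (O (s + j)%N))%E).
    by apply: measure_sigma_subadditive => //; exact: bigcupT_measurable.
  apply: le_trans (epsilon_trick0 xpredT (ltW (th0 s))).
  apply: lee_nneseries => // j _; case: (OP (s + j)%N) => _ _ /le_trans; apply.
  rewrite lee_fin ler_pM ?invr_ge0 ?(ltW (th0 _))//.
  by rewrite lef_pV2 ?posrE ?ltr0n ?expn_gt0// ler_nat leq_pexp2l// ltnS leq_addl.
pose H s := odd_part (G s); pose Hoo := odd_part (fun k => \bigcup_t G t k).
have mH s : measurable (H s) by exact: measurable_odd_part.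
have mHoo : measurable Hoo.
  by apply: measurable_odd_part => k; exact: bigcupT_measurable.
have limitP s x : ~ (\bigcup_j O (s + j)%N) x -> Hoo x <-> H s x.
  exact: (@odd_part_limit _ _ rho K a O G).
have mU : measurable (\bigcup_j O j) by exact: bigcupT_measurable.
have finU : (mu (\bigcup_j O j) < +oo)%E.
  by apply: le_lt_trans (ltry (th 0%N)); exact: (tail 0%N).
have HU s : H s `<=` \bigcup_j O j.
  exact: (@odd_part_sub _ _ rho K rhoxx K0 a O G).
exists H, Hoo; split.
- move=> s; split => //; apply: le_lt_trans finU.
  by apply: le_measure; rewrite ?inE.
- split => //; apply: le_lt_trans finU; apply: le_measure; rewrite ?inE//.
  move=> x Hx; apply: contrapT => nx; apply: (nx); apply: (HU 0%N).
  exact/(limitP 0%N).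
- move=> s; apply: (@le_trans _ _ (mu (\bigcup_j O (s + j)%N))); last first.
    by apply: le_trans (tail s) _; rewrite lee_fin.
  apply: le_measure; rewrite ?inE//.
  + by apply: measurableU; exact: measurableD.
  + by apply: bigcupT_measurable.
  by move=> x Hx; apply: contrapT => /limitP; case: Hx => -[h1 h2] [h3 h4]; auto.
- move=> x Ex b n.
  apply: (tower_oscillate rhoxx rhoC K0 rho_tri a0 a_nincr (erefl (G 0%N)) GS) => //.
  by move=> s; case: (OP s) => _ + _; exact.
Qed.

End oscillating_sets.

(** * Upper and lower limits of oscillating sequences *)

Lemma le_limn_esup (R : realType) (u : nat -> R) (c : R) :
  (forall n e, 0 < e -> exists2 m, (n <= m)%N & c - e <= u m) ->
  (c%:E <= limn_esup (EFin \o u))%E.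
Proof.
move=> uc; apply: le_ereal_inf_tmp => _ [A [N _ NA] <-].
apply/lee_addgt0Pr => e e0; have [m Nm cu] := uc N e e0.
apply: (@le_trans _ _ ((u m)%:E + e%:E)%E).
  by rewrite -EFinD lee_fin -lerBlDr.
by rewrite leeD2r//; apply: ereal_sup_ubound; exists m => //; exact: NA.
Qed.

Lemma oscillating_seq (R : realType) (u : nat -> R) :
  (forall (b : bool) n e, 0 < e -> exists2 m, (n <= m)%N & `|u m - b%:R| <= e) ->
  [/\ ~ cvgn u, (1 <= limn_esup (fun n => (u n)%:E))%E &
      (limn_einf (fun n => (u n)%:E) <= 0)%E].
Proof.
move=> uosc.
have sup1 : (1 <= limn_esup (fun n => (u n)%:E))%E.
  apply: le_limn_esup => n e e0; have [m nm um] := uosc true n e e0.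
  by move: um; rewrite ler_distl => /andP[? _]; exists m.
have inf0 : (limn_einf (fun n => (u n)%:E) <= 0)%E.
  rewrite /limn_einf leeNl oppe0.
  apply: (@le_limn_esup _ (fun k => - u k)) => m0 e e0.
  have [m nm um] := uosc false m0 e e0; exists m => //.
  by move: um; rewrite subr0 ler_norml sub0r lerN2 => /andP[].
split => // /cvg_ex[l ul].
have [i s] : (limn_einf (EFin \o u) = l%:E) * (limn_esup (EFin \o u) = l%:E).
  by apply: cvg_limn_einf_sup; apply: cvg_EFin => //; exact: nearW.
move: sup1 inf0; rewrite -[fun n => _]/(EFin \o u) i s => l1 l0.
by have := le_trans l1 l0; rewrite lee_fin ler10.
Qed.

(** * Operators of finite norm from L1 to bounded functions *)

Section operators_on_L1.
Set Implicit Arguments.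
Unset Strict Implicit.
Context (R : realType) (d : measure_display) (X : measurableType d)
  (mu : {measure set X -> \bar R}).

Lemma op_norm_bound (T : {linear L1 mu -> (X -> R)}) : (op_norm T < +oo)%E ->
  exists2 C : R, 0 <= C & forall (g : L1 mu) (e : R) x, 0 < e ->
    ('N[mu]_1%E[EFin \o g] <= e%:E)%E -> `|T g x| <= C * e.
Proof.
move=> Tfin.
(* on an empty space the norm is a supremum over nothing and equals [-oo] *)
set M := maxe 0%E (op_norm T).
have M0 : (0 <= M)%E by rewrite le_max lexx.
have Mfin : M \is a fin_num by rewrite ge0_fin_numE// gt_max ltry.
exists (fine M); first exact: fine_ge0.
move=> g e x e0 ge.
have : (`|T (e^-1 *: g) x|%:E <= M)%E.
  rewrite le_max; apply/orP; right.
  apply: (@le_trans _ _ (sup_norm (T (e^-1 *: g)))).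
    by apply: ereal_sup_ubound; exists x.
  apply: ereal_sup_ubound; exists (e^-1 *: g) => //=.
  apply: (@le_trans _ _ ('N[mu]_1%E[EFin \o (e^-1 \*: g)])%E); first by [].
  rewrite LnormZ gtr0_norm ?invr_gt0// muleC.
  by rewrite lee_pdivrMr// mul1e.
rewrite linearZ/= normrM gtr0_norm ?invr_gt0// => le.
by rewrite -ler_pdivrMr// mulrC -lee_fin (fineK Mfin).
Qed.

Lemma indic_Lfun (A : set X) : measurable A -> (mu A < +oo)%E ->
  exists f : L1 mu, (f : X -> R) = \1_A.
Proof.
move=> mA finA.
have fA : (\1_A : X -> R) \in Lfun mu 1.
  apply/Lfun1_integrable; apply/integrableP; split.
    exact/measurable_EFinP.
  rewrite (eq_integral (EFin \o (\1_A : X -> R))); last first.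
    by move=> x _ /=; rewrite ger0_norm.
  by rewrite integral_indic// setIT.
by exists (Lfun_Sub (lexx 1%E) fA).
Qed.

Lemma Lnorm_indicB (A B : set X) (f g : L1 mu) : measurable A -> measurable B ->
  (f : X -> R) = \1_A -> (g : X -> R) = \1_B ->
  ('N[mu]_1%E[EFin \o (f - g)%R] = mu ((A `\` B) `|` (B `\` A)))%E.
Proof.
move=> mA mB fA gB; rewrite Lnorm1 -[in RHS](setIT (_ `|` _)) -integral_indic//;
  last by apply: measurableU; exact: measurableD.
apply: eq_integral => x _ /=.
rewrite fA gB -[(\1_A - \1_B) x]/(\1_A x - \1_B x) !indicE in_setU !in_setD.
by case: (x \in A); case: (x \in B);
  rewrite /= ?subrr ?subr0 ?sub0r ?normrN ?normr1 ?normr0.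
Qed.

End operators_on_L1.

(** * Localization *)

Section settling.
Set Implicit Arguments.
Unset Strict Implicit.
Context (R : realType) (d : measure_display) (X : measurableType d)
    (rho : X -> X -> R) (K : R) (mu : {measure set X -> \bar R})
    (U : nat -> {linear L1 mu -> (X -> R)}).
Hypothesis rhoC : forall x y, rho x y = rho y x.
Hypothesis K0 : 0 < K.
Hypothesis rho_tri : forall x y z, rho x y <= K * (rho x z + rho z y).
Hypothesis rhoxx : forall x, rho x x = 0.
Hypothesis loc : forall (f : L1 mu) (G E : set X) (c : R),
      qopen rho G -> (forall x, G x -> f x = c) -> well_inside rho E G ->
      {uniform E, (fun n => U n f) @ \oo --> (f : X -> R)}.

(** [f] is constant on the interior of [A], and the points at depth [r] in [A]
    lie well inside it, so the convergence is uniform on [P]. *)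
Lemma settling_on (f : L1 mu) (A P : set X) (c r e : R) : 0 < r -> 0 < e ->
  (forall x, A x -> f x = c) -> (forall x, P x -> qball rho x r `<=` A) ->
  exists N, forall n, (N <= n)%N -> forall x, P x -> `|U n f x - c| <= e.
Proof.
move=> r0 e0 fc PA.
have fc' x : qint rho A x -> f x = c by move=> /(qint_sub rhoxx) /fc.
have Pin := well_inside_qint rhoC K0 rho_tri r0 PA.
have Ucvg := loc (open_qint K0 rho_tri (A := A)) fc' Pin.
have near_f : nbhs ((f : X -> R) : {uniform` P -> R})
    [set h : X -> R | forall x, P x -> ball (f x) e (h x)].
  apply/uniform_nbhs; exists [set xy | ball xy.1 e xy.2]; split => //.
  exact: entourage_ball (PosNum e0).
have [N _ NP] := Ucvg _ near_f.
exists N => n Nn x Px; have := NP n Nn x Px.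
by rewrite (fc x (PA x Px x (qball_center rhoxx _ r0))) /ball /= distrC => /ltW.
Qed.

Lemma settling (H : set X) (f : L1 mu) (r e : R) (n0 : nat) :
  (f : X -> R) = \1_H -> 0 < r -> 0 < e -> exists2 n, (n0 <= n)%N &
  forall (b : bool) x, (forall y, rho y x < r -> H y <-> b) ->
    `|U n f x - b%:R| <= e.
Proof.
move=> fH r0 e0.
have [N1 N1P] : exists N, forall n, (N <= n)%N -> forall x,
    (qball rho x r `<=` H) -> `|U n f x - 1| <= e.
  by apply: (settling_on (A := H) r0 e0) => // x Hx; rewrite fH indicE mem_set.
have [N0 N0P] : exists N, forall n, (N <= n)%N -> forall x,
    (qball rho x r `<=` ~` H) -> `|U n f x - 0| <= e.
  by apply: (settling_on (A := ~` H) r0 e0) => // x Hx; rewrite fH indicE memNset.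
exists (n0 + (N0 + N1))%N; first exact: leq_addr.
move=> [] x xb; [apply: N1P|apply: N0P].
- by rewrite addnA leq_addl.
- by move=> y /xb[_]; exact.
- by rewrite addnCA leq_addr.
- by move=> y /xb[Hb _] /Hb.
Qed.

End settling.

Theorem theorem1p3 (R : realType) (d : measure_display) (X : measurableType d)
    (rho : X -> X -> R) (mu : {measure set X -> \bar R})
    (U : nat -> {linear L1 mu -> (X -> R)}) :
  homogeneous_type rho mu ->
  borel_null_sets rho mu ->
  (forall n (f : L1 mu), bounded_measurable (U n f)) ->
  (forall n, (op_norm (U n) < +oo)%E) ->
  (forall (f : L1 mu) (G E : set X) (c : R),
      qopen rho G -> (forall x, G x -> f x = c) -> well_inside rho E G ->
      {uniform E, (fun n => U n f) @ \oo --> (f : X -> R)}) ->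
  forall E : set X, measurable E -> mu E = 0%E ->
    exists (G : set X) (f : L1 mu),
      (f : X -> R) = \1_G /\
      forall x, E x ->
        [/\ ~ cvgn (fun n => U n f x),
            (1 <= limn_esup (fun n => (U n f x)%:E))%E &
            (limn_einf (fun n => (U n f x)%:E) <= 0)%E].
Proof.
move=> [[_ rho_eq0 rhoC [K K0 rho_tri]] borelm mball [Cd dbl]].
move=> bnull _ Ufin loc E mE E0.
have rhoxx x : rho x x = 0 by apply/rho_eq0.
have mopen A : qopen rho A -> measurable A.
  by move=> oA; apply: borelm; exact: sub_sigma_algebra.
have finball x r : 0 < r -> (mu (qball rho x r) < +oo)%E.
  by move=> r0; have [] := dbl x r r0.
have Ecover (e : R) : 0 < e ->
    exists O, [/\ qopen rho O, E `<=` O & (mu O <= e%:E)%E].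
  move=> e0; have [B [bB EB B0]] := bnull E mE E0.
  have [V [oV BV Ve]] :=
    borel_null_cover rhoxx rhoC K0 rho_tri mopen mball finball bB B0 e0.
  by exists V; split => //; exact: subset_trans BV.
pose a s : R := s.+1%:R^-1.
have a0 s : 0 < a s by rewrite invr_gt0.
have a_nincr s t : (s <= t)%N -> a t <= a s.
  by move=> st; rewrite lef_pV2 ?posrE// ler_nat.
have a_cvg (e : R) : 0 < e -> exists n, a n < e by exact: ex_natSinv_lt.
have /choice[C CP] : forall n, exists C : R, 0 <= C /\
    forall (g : L1 mu) (e : R) x, 0 < e ->
    ('N[mu]_1%E[EFin \o g] <= e%:E)%E -> `|U n g x| <= C * e.
  by move=> n; have [c c0 cP] := op_norm_bound (Ufin n); exists c.
(* a time at which the operators have settled for the set [H], to within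
   [a s], at all points whose ball of radius [a s] lies in [H] or misses it *)
have /choice[nu nuP] : forall sH : nat * set X, exists n,
    forall f : L1 mu, (f : X -> R) = \1_(sH.2) -> (sH.1 <= n)%N /\
    forall (b : bool) x, (forall y, rho y x < a sH.1 -> sH.2 y <-> b) ->
      `|U n f x - b%:R| <= a sH.1.
  move=> [s H] /=.
  have [[f fH]|nf] := pselect (exists f : L1 mu, (f : X -> R) = \1_H); last first.
    by exists 0%N => f fH; exfalso; apply: nf; exists f.
  have [n sn nP] := settling rhoC K0 rho_tri rhoxx loc s fH (a0 s) (a0 s).
  exists n => g gH; suff -> : g = f by [].
  by apply/LfuneqP => x; rewrite fH gH.
(* with this error bound, replacing [H s] by the limit set changes the values of
   [U (nu (s, H s))] on the indicator by at most [a s] *)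
pose Phi s H := a s / (C (nu (s, H)) + 1).
have C1 n : 0 < C n + 1 by rewrite ltr_wpDl//; case: (CP n).
have Phi0 s H : 0 < Phi s H by rewrite divr_gt0.
have [H [Hoo [finH [mHoo finHoo] HHoo Hosc]]] :=
  exists_oscillating_sets rhoxx rhoC K0 rho_tri mopen Ecover a0 a_nincr a_cvg Phi0.
have [f fH] := indic_Lfun mHoo finHoo.
exists Hoo, f; split => // x Ex; apply: oscillating_seq => b n e e0.
have [N aN] := a_cvg _ (divr_gt0 e0 (ltr0n R 2)).
have [t Nt xt] := Hosc x Ex b (maxn n N).
have [mHt finHt] := finH t; have [h hH] := indic_Lfun mHt finHt.
have [tn /(_ b x xt) Uh] := nuP (t, H t) h hH.
exists (nu (t, H t)).
  by apply: leq_trans tn; apply: leq_trans Nt; exact: leq_maxl.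
set m := nu (t, H t) in Uh tn *.
have Ud : `|U m (h - f) x| <= a t.
  have [C0 /(_ (h - f) (Phi t (H t)) x (Phi0 _ _))] := CP m.
  rewrite (Lnorm_indicB mHt mHoo hH fH) => /(_ (HHoo t)) /le_trans; apply.
  rewrite /Phi -/m mulrCA ler_piMr ?(ltW (a0 _))//.
  by rewrite ler_pdivrMr// mul1r lerDl.
have at2 : a t <= e / 2.
  apply: le_trans (ltW aN); apply: a_nincr; apply: leq_trans Nt; exact: leq_maxr.
have -> : U m f x - b%:R = (U m h x - b%:R) - U m (h - f) x.
  rewrite linearB -[(U m h - U m f) x]/(U m h x - U m f x).
  by rewrite opprB [RHS]addrC addrA subrK.
apply: le_trans (ler_normB _ _) _; rewrite [e]splitr.
by apply: lerD; [apply: le_trans Uh _|apply: le_trans Ud _].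
Qed.
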